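(* Let $H$ be a locally tame strongly primary monoid. 1. We have \[ \mathsf c(H) \le \min\left\{ 1 + \Lambda(H),\ \max\{\mathcal M(u) - 1,\ \mathsf t(H, uH^\times)\} : u \in \mathcal A(H) \right\}, \] that is, $\mathsf c(H) \le 1 + \Lambda(H)$ and $\mathsf c(H) \le \max\{\mathcal M(u)-1, \mathsf t(H,uH^\times)\}$ for every $u \in \mathcal A(H)$. In particular, the set of distances $\Delta(H)$ is finite. 2. Suppose that $\Delta(H) \neq \emptyset$ and set $d = \min \Delta(H)$. (a) There exists $M \in \mathbb N_0$ such that, for every $a \in H$, \[ \big(\min \mathsf L(a) + d\cdot \mathbb N_0\big) \cap [\![ \min \mathsf L(a) + M, \max \mathsf L(a) - M ]\!] \subset \mathsf L(a) \subset \min \mathsf L(a) + d \cdot \mathbb N_0. \] (b) There exists $M' \in \mathbb N_0$ such that, for every $k \in \mathbb N$, \[ \big(\lambda_k(H) + d \cdot \mathbb N_0\big) \cap [\![ \lambda_k(H) + M', \rho_k(H) - M' ]\!] \subset \mathscr U_k(H) \subset \lambda_k(H) + d\cdot \mathbb N_0. \]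
   Context: A monoid $H$ is a commutative cancellative semigroup with identity, written multiplicatively; $H^\times$ is its group of invertible elements, $H_{\mathrm{red}} = H/H^\times = \{aH^\times : a \in H\}$, and $\mathcal A(H)$ its set of atoms (non-invertible elements that are not products of two non-invertible elements). $\mathbb N$ is the set of positive integers. $H$ is strongly primary if $H \neq H^\times$ and for each $a \in H \setminus H^\times$ there is $n \in \mathbb N$ with $(H\setminus H^\times)^n \subset aH$ (here $X^n$ is the set of products of $n$ elements of $X$); $\mathcal M(a)$ denotes the smallest such $n$. Strongly primary monoids are BF-monoids, i.e. all sets $\mathsf L(a)$ defined below are finite and non-empty. A factorization of $a \in H$ is a finite multiset $z$ of atoms of $H_{\mathrm{red}}$ with product $aH^\times$; $|z|$ is its cardinality with multiplicities; $\mathsf Z(a)$ is the set of factorizations of $a$; $\mathsf L(a) = \{|z| : z \in \mathsf Z(a)\}$ (so $\mathsf L(a) = \{0\}$ for $a \in H^\times$); $\mathscr L(H) = \{\mathsf L(a) : a \in H\}$. For $z,z' \in \mathsf Z(a)$, removing the largest common sub-multiset leaves disjoint multisets of sizes $m$ and $n$, and $\mathsf d(z,z') = \max\{m,n\}$. For $u \in \mathcal A(H_{\mathrm{red}})$, the local tame degree $\mathsf t(H,u)$ is the smallest $N \in \mathbb N_0 \cup\{\infty\}$ such that: for each $a \in H$ having a factorization that contains $u$, and each $z \in \mathsf Z(a)$, there is $z' \in \mathsf Z(a)$ containing $u$ with $\mathsf d(z,z') \le N$. $H$ is locally tame if $\mathsf t(H,u) < \infty$ for all $u \in \mathcal A(H_{\mathrm{red}})$.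 $\Lambda(H) = \sup\{\min \mathsf L(a) : a \in H\} \in \mathbb N_0 \cup \{\infty\}$. The catenary degree $\mathsf c(a)$ of $a\in H$ is the smallest $N \in \mathbb N_0$ such that any two $z,z' \in \mathsf Z(a)$ can be joined by a sequence $z = z_0, z_1, \dots, z_k = z'$ in $\mathsf Z(a)$ with $\mathsf d(z_{i-1},z_i) \le N$ for all $i$; $\mathsf c(H) = \sup\{\mathsf c(a) : a \in H\} \in \mathbb N_0\cup\{\infty\}$. For a finite set $L = \{m_1 < \dots < m_k\} \subset \mathbb Z$, $\Delta(L) = \{m_i - m_{i-1} : 2 \le i \le k\}$, and $\Delta(H) = \bigcup_{L \in \mathscr L(H)} \Delta(L)$. For $k \in \mathbb N$, $\mathscr U_k(H) = \bigcup_{k \in L \in \mathscr L(H)} L$, $\rho_k(H) = \sup \mathscr U_k(H) \in \mathbb N \cup \{\infty\}$, and $\lambda_k(H) = \min \mathscr U_k(H)$. $[\![a,b]\!] = \{x \in \mathbb Z : a \le x \le b\}$ (empty if $a > b$), with $\infty \pm m = \infty$ for $m \in \mathbb N_0$ and $[\![m,\infty]\!] = \{x \in \mathbb Z : x \ge m\}$. For $m,d \in \mathbb Z$, $m + d \cdot \mathbb N_0 = \{m + dj : j \in \mathbb N_0\}$. *)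

(* Defs.v *)
From HB Require Import structures.
From mathcomp Require Import all_boot all_order all_algebra.
From mathcomp Require Import generic_quotient finmap multiset.
From mathcomp Require Import boolp classical_sets functions cardinality.
From mathcomp Require Import constructive_ereal.

Set Implicit Arguments.
Unset Strict Implicit.
Unset Printing Implicit Defensive.

Import Order.TTheory GRing.Theory Num.Theory.

Local Open Scope classical_set_scope.
Local Open Scope quotient_scope.
Local Open Scope group_scope.

HB.mixin Record Monoid_isComCancel H of Monoid H := {
  cmulC : forall a b : H, a * b = b * a;
  cmulI : forall a : H, injective (fun b => a * b)
}.

#[short(type="ccMonoidType")]
HB.structure Definition ComCancelMonoid :=
  { H of Monoid_isComCancel H & Monoid H }.

(* The default x0 is returned when A has no least (resp. greatest) element. *)
Definition least d (T : porderType d) (x0 : T) (A : set T) : T :=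
  xget x0 (A `&` lbound A).

Definition greatest d (T : porderType d) (x0 : T) (A : set T) : T :=
  xget x0 (A `&` ubound A).

(* Invariants with values in N_0 u {oo} or Z u {oo} live in \bar int, in which
   every set has a supremum, so the default of supremum only matters for the
   empty set. emin P is the least element of P, and +oo when P is empty. *)
Definition esup (A : set (\bar int)) : \bar int := supremum -oo%E A.

Definition emin (P : set nat) : \bar int :=
  least +oo%E [set (N%:Z)%:E | N in P].

Definition zitv (a b : \bar int) : set int :=
  [set x : int | (a <= x%:E <= b)%E].

Definition zap (m d : int) : set int :=
  [set (m + d * j%:Z)%R | j in [set: nat]].

(* Differences of two consecutive elements of L. *)
Definition set_distances (L : set int) : set int :=
  [set d | exists m n : int, [/\ L m, L n, (m < n)%R,
     forall l : int, L l -> ~~ (m < l < n)%R & d = (n - m)%R]].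

Section Arithmetic.
Variable H : ccMonoidType.
Implicit Types (a b c : H) (X : set H) (n : nat).

Definition units : set H := [set a | exists b, a * b = 1].

Definition atoms : set H :=
  [set a | ~ units a /\ forall b c, a = b * c -> units b \/ units c].

Definition lcos a X : set H := [set a * x | x in X].

Definition set_pow X n : set H :=
  [set \prod_(x <- s) x | s in
     [set s : seq H | size s = n /\ forall x, x \in s -> X x]].

(* The exponents n >= 1 with (H \ H^x)^n included in aH. *)
Definition power_in a : set nat :=
  [set n | (0 < n)%N /\ set_pow (~` units) n `<=` lcos a setT].

Definition strongly_primary : Prop :=
  units <> setT /\ forall a, ~ units a -> power_in a !=set0.

Definition calM a : nat := least 0%N (power_in a).

(* H_red is the quotient by equality of the cosets a H^x. *)
Definition associated (a b : H) : bool := `[< lcos a units = lcos b units >].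

Fact associated_refl : reflexive associated.
Proof. by move=> a; apply/asboolP. Qed.

Fact associated_sym : symmetric associated.
Proof. by move=> a b; apply: asbool_equiv_eq; split. Qed.

Fact associated_trans : transitive associated.
Proof. by move=> b a c /asboolP e1 /asboolP e2; apply/asboolP; rewrite e1. Qed.

Canonical associated_equiv := EquivRel associated associated_refl associated_sym associated_trans.

Definition reduced : Type := {eq_quot associated}.

HB.instance Definition _ := EqQuotient.on reduced.
HB.instance Definition _ := Choice.on reduced.

Definition pi_red a : reduced := \pi_reduced%qT a.

Lemma units1 : units 1.
Proof. by exists 1; rewrite mul1g. Qed.

Lemma unitsM a b : units a -> units b -> units (a * b).
Proof.
move=> [a' aa'] [b' bb']; exists (b' * a').
by rewrite mulgA -(mulgA a) bb' mulg1.
Qed.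

Lemma associatedP a b : reflect (exists2 e, units e & b = a * e) (associated a b).
Proof.
apply: (iffP (asboolP _)) => [E|[e [f ef] ->]].
  have : lcos b units b by exists 1; [exact: units1 | rewrite mulg1].
  by rewrite -E => -[e ue <-]; exists e.
apply/seteqP; split => _ [u uu <-]; last first.
  by exists (e * u); [apply: unitsM => //; exists f | rewrite mulgA].
exists (f * u); first by apply: unitsM => //; exists e; rewrite cmulC.
by rewrite -mulgA (mulgA e) ef mul1g.
Qed.

Lemma pi_redP a b : reflect (pi_red a = pi_red b) (associated a b).
Proof.
have -> : associated a b = (pi_red a == pi_red b) by rewrite /pi_red eqmodE.
exact: eqP.
Qed.

Lemma repr_associated a : associated a (repr (pi_red a)).
Proof. by apply/pi_redP; rewrite /pi_red reprK. Qed.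

Definition red_one : reduced := pi_red 1.
Definition red_mul (x y : reduced) : reduced := pi_red (repr x * repr y).

Lemma red_mulE a b : red_mul (pi_red a) (pi_red b) = pi_red (a * b).
Proof.
apply/esym/pi_redP/associatedP.
have /associatedP[e ue ->] := repr_associated a; have /associatedP[f uf ->] := repr_associated b.
exists (e * f); first exact: unitsM.
by rewrite -!mulgA; congr (_ * _); rewrite !mulgA (cmulC e).
Qed.

Lemma pi_red_surj (x : reduced) : exists a, x = pi_red a.
Proof. by exists (repr x); rewrite /pi_red reprK. Qed.

Fact red_mulA : associative red_mul.
Proof.
move=> x y z; have [a ->] := pi_red_surj x; have [b ->] := pi_red_surj y.
by have [c ->] := pi_red_surj z; rewrite !red_mulE mulgA.
Qed.

Fact red_mul1 : left_id red_one red_mul.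
Proof. by move=> x; have [a ->] := pi_red_surj x; rewrite red_mulE mul1g. Qed.

Fact red_mulr1 : right_id red_one red_mul.
Proof. by move=> x; have [a ->] := pi_red_surj x; rewrite red_mulE mulg1. Qed.

HB.instance Definition _ :=
  isMonoid.Build reduced red_mulA red_mul1 red_mulr1.

Fact red_mulC : forall x y : reduced, x * y = y * x.
Proof.
move=> x y; have [a ->] := pi_red_surj x; have [b ->] := pi_red_surj y.
by rewrite [LHS]red_mulE [RHS]red_mulE cmulC.
Qed.

Fact red_mulI (x : reduced) : injective (fun y => x * y).
Proof.
have [a ->] := pi_red_surj x => y z.
have [b ->] := pi_red_surj y; have [c ->] := pi_red_surj z.
rewrite /= [LHS]red_mulE [RHS]red_mulE => /pi_redP/associatedP[e ue acE].
by apply/pi_redP/associatedP; exists e => //; apply: (@cmulI _ a); rewrite acE mulgA.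
Qed.

HB.instance Definition _ :=
  Monoid_isComCancel.Build reduced red_mulC red_mulI.

End Arithmetic.

Section Factorizations.
Local Open Scope mset_scope.
Variable H : ccMonoidType.
Implicit Types (a : H) (u : reduced H) (z : {mset reduced H}) (N k : nat).

Definition factorizations a : set {mset reduced H} :=
  [set z | (forall u, u \in z -> atoms u)
           /\ (\prod_(u <- enum_mset z) u)%g = pi_red a].

Definition fdist z z' : nat :=
  maxn (size (z `\` z')%mset) (size (z' `\` z)%mset).

Definition lengths a : set int :=
  [set ((size z)%:Z)%R | z in factorizations a].

Definition minL a : int := least 0%R (lengths a).
Definition maxL a : int := greatest 0%R (lengths a).

Definition tame_degree u : \bar int :=
  emin [set N | forall a,
    (exists2 z, factorizations a z & u \in z) ->
    forall z, factorizations a z ->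
    exists z', [/\ factorizations a z', u \in z' & (fdist z z' <= N)%N]].

Definition catenary_elt a : \bar int :=
  emin [set N | forall z z', factorizations a z -> factorizations a z' ->
    exists s : seq {mset reduced H},
      [/\ forall y, y \in s -> factorizations a y,
          path (fun x y => (fdist x y <= N)%N) z s & last z s = z']].

End Factorizations.

Definition locally_tame (H : ccMonoidType) : Prop :=
  forall u : reduced H, atoms u -> (tame_degree u < +oo)%E.

Definition Lambda (H : ccMonoidType) : \bar int :=
  esup [set (minL a)%:E | a in [set: H]].

Definition catenary (H : ccMonoidType) : \bar int :=
  esup [set catenary_elt a | a in [set: H]].

Definition sets_of_lengths (H : ccMonoidType) : set (set int) :=
  range (@lengths H).

Definition Delta (H : ccMonoidType) : set int :=
  \bigcup_(L in sets_of_lengths H) set_distances L.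

Definition calU (H : ccMonoidType) (k : nat) : set int :=
  \bigcup_(L in [set L | sets_of_lengths H L /\ L (k%:Z)%R]) L.

Definition rho (H : ccMonoidType) (k : nat) : \bar int :=
  esup [set x%:E | x in calU H k].

Definition lambda (H : ccMonoidType) (k : nat) : int := least 0%R (calU H k).

(* Main.v *)
(* Let u be an atom and n = M(u). Every element with a factorization of length at
   least n is a multiple of u, so tameness moves any two of its factorizations,
   by steps of size t(H, u), to factorizations containing u; cancelling u and
   inducting bounds the catenary degree. The bound 1 + Lambda comes from
   shortening: in a factorization with more than 1 + Lambda atoms, 1 + Lambda of
   them can be refactored into at most Lambda.

   For the structure of sets of lengths, let b have lengths m0 and m0 + d. The
   lengths of b^k contain a progression with difference d and k + 1 terms. If the
   diameter k d exceeds all distances, then the lengths of b^k c contain every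
   number in the right residue class between about min L(c) and max L(c), and
   when b^k c = a, tameness bounds min L(c) - min L(a) and max L(a) - max L(c).
   For the unions U_k, the part away from k is covered by single sets of lengths
   and the part near k by those of b^(2M) u^(k-i), with i the middle length of
   b^(2M). *)

Require Import Defs.
From HB Require Import structures.
From mathcomp Require Import all_boot all_order all_algebra.
From mathcomp Require Import finmap multiset.
From mathcomp Require Import boolp classical_sets functions cardinality.
From mathcomp Require Import constructive_ereal.
From mathcomp Require Import zify.

Set Implicit Arguments.
Unset Strict Implicit.
Unset Printing Implicit Defensive.

Import Order.TTheory GRing.Theory Num.Theory.

Local Open Scope classical_set_scope.

(** * Least and greatest elements, suprema in the extended integers *)

Lemma ex_least_nat (P : set nat) :
  P !=set0 -> exists2 m, P m & forall k, P k -> (m <= k)%N.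
Proof.
move=> [n Pn]; have exP : exists n, `[< P n >] by exists n; apply/asboolP.
case: (ex_minnP exP) => m /asboolP Pm le_m; exists m => // k Pk.
by apply: le_m; apply/asboolP.
Qed.

Lemma least_eq d (T : porderType d) (x0 x : T) (A : set T) :
  A x -> lbound A x -> least x0 A = x.
Proof.
move=> Ax lbx; apply: xget_unique => // y [Ay lby].
by apply/eqP; rewrite eq_le lbx // lby.
Qed.

Lemma greatest_eq d (T : porderType d) (x0 x : T) (A : set T) :
  A x -> ubound A x -> greatest x0 A = x.
Proof.
move=> Ax ubx; apply: xget_unique => // y [Ay uby].
by apply/eqP; rewrite eq_le ubx // uby.
Qed.

Lemma int_least (A : set int) (b : int) :
  A !=set0 -> lbound A b -> exists2 x, A x & lbound A x.
Proof.
move=> [x Ax] lbb.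
have [|m Am le_m] := @ex_least_nat [set n | A (b + n%:Z)%R].
  exists `|x - b|%N => /=; rewrite gez0_abs; last by have := lbb _ Ax; lia.
  by rewrite subrKC.
exists (b + m%:Z)%R => // y Ay; have := lbb _ Ay.
suff : (m <= `|y - b|)%N by lia.
by apply: le_m => /=; rewrite gez0_abs ?subrKC //; have := lbb _ Ay; lia.
Qed.

Lemma int_greatest (A : set int) (b : int) :
  A !=set0 -> ubound A b -> exists2 x, A x & ubound A x.
Proof.
move=> [x Ax] ubb.
have [||y [z Az <-] lby] := @int_least [set (- z)%R | z in A] (- b)%R.
- by exists (- x)%R, x.
- by move=> _ [z Az <-]; rewrite lerN2 ubb.
exists z => // w Aw; rewrite -lerN2; apply: lby.
by exists w.
Qed.

Lemma least_mem (A : set int) (b : int) : A !=set0 -> lbound A b ->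
  A (least 0%R A) /\ lbound A (least 0%R A).
Proof.
by move=> A0 /(int_least A0)[x Ax lbx]; rewrite (least_eq _ Ax lbx).
Qed.

Lemma greatest_mem (A : set int) (b : int) : A !=set0 -> ubound A b ->
  A (greatest 0%R A) /\ ubound A (greatest 0%R A).
Proof.
by move=> A0 /(int_greatest A0)[x Ax ubx]; rewrite (greatest_eq _ Ax ubx).
Qed.

Lemma emin_mem (P : set nat) : P !=set0 -> exists2 N, P N & emin P = (N%:Z)%:E.
Proof.
move=> /ex_least_nat[N PN le_N]; exists N => //.
apply: least_eq => [|_ [n Pn <-]]; first by exists N.
by rewrite lee_fin lez_nat le_N.
Qed.

Lemma emin_le (P : set nat) N : P N -> (emin P <= (N%:Z)%:E)%E.
Proof.
move=> PN; have [|n Pn le_n] := @ex_least_nat P; first by exists N.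
have -> : emin P = (n%:Z)%:E; last by rewrite lee_fin lez_nat le_n.
apply: least_eq => [|_ [m Pm <-]]; first by exists n.
by rewrite lee_fin lez_nat le_n.
Qed.

Lemma emin_ltoo (P : set nat) : (emin P < +oo)%E ->
  exists2 N, P N & emin P = (N%:Z)%:E.
Proof.
have [-> |/set0P] := eqVneq P set0; last by move=> /emin_mem.
rewrite /emin image_set0 /least; case: xgetP => [x _ [[]]|_].
by rewrite ltxx.
Qed.

(** Bounded non-empty sets of integers have a maximum, so the supremum is either attained or
    infinite. For the empty set the default [-oo] is the right value. *)
Lemma esup_lub (A : set (\bar int)) :
  ubound A (esup A) /\ lbound (ubound A) (esup A).
Proof.
rewrite /esup /supremum; case: eqP => [->|/eqP/set0P[x0 Ax0]].
  by split=> [?[]|y _]; rewrite leNye.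
suff : supremums A !=set0 by move=> /(xgetPex -oo%E).
have [Aoo|Aoo] := pselect (A +oo%E).
  by exists +oo%E; split=> [y _|y]; [rewrite leey | apply].
pose B := [set x : int | A x%:E].
have [B0|/set0P B0] := eqVneq B set0.
  exists -oo%E; split=> [[y||]// Ay|y _]; last by rewrite leNye.
  by have : B y by []; rewrite B0.
have [[b ubb]|nub] := pselect (exists b, ubound B b).
  have [x Bx ubx] := int_greatest B0 ubb.
  exists x%:E; split=> [[y||] Ay|y]; [|by []|exact: leNye|exact].
  by rewrite lee_fin ubx.
exists +oo%E; split=> [y _|[y||] uby]; rewrite ?leey //; exfalso.
  by apply: nub; exists y => z Bz; have := uby _ Bz; rewrite lee_fin.
by case: B0 => z Bz; have := uby _ Bz.
Qed.

Lemma le_esup (A : set (\bar int)) x : A x -> (x <= esup A)%E.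
Proof. by move=> Ax; case: (esup_lub A) => + _; apply. Qed.

Lemma esup_le (A : set (\bar int)) y :
  (forall x, A x -> (x <= y)%E) -> (esup A <= y)%E.
Proof. by move=> ub; case: (esup_lub A) => _; apply. Qed.

(** Commutativity lets [perm_big] reorder products over enumerations of multisets. *)
HB.instance Definition _ (K : ccMonoidType) :=
  SemiGroup.isCommutativeLaw.Build K *%g (@cmulC K).

(** * Sizes and products of multisets *)

Section MultisetExtra.
Local Open Scope mset_scope.

Lemma perm_enum_msetD (K : choiceType) (z w : {mset K}) :
  perm_eq (enum_mset (z `+` w)) (enum_mset z ++ enum_mset w).
Proof.
apply/eq_seq_msetP/msetP => u.
by rewrite seq_mset_id mset_seqE count_cat !count_mem_mset msetE2.
Qed.

Lemma size_msetD (K : choiceType) (z w : {mset K}) :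
  size (z `+` w) = (size z + size w)%N.
Proof. by rewrite (perm_size (perm_enum_msetD z w)) size_cat. Qed.

Lemma size_mset1 (K : choiceType) (u : K) : size [mset u] = 1%N.
Proof. by rewrite enum_msetn. Qed.

Lemma size_seq_mset (K : choiceType) (s : seq K) : size (seq_mset s) = size s.
Proof. exact/perm_size/perm_eq_seq_mset. Qed.

Definition mprod (K : ccMonoidType) (z : {mset K}) : K :=
  (\prod_(u <- enum_mset z) u)%g.

Lemma mprodD (K : ccMonoidType) (z w : {mset K}) :
  mprod (z `+` w) = (mprod z * mprod w)%g.
Proof. by rewrite /mprod (perm_big _ (perm_enum_msetD z w)) big_cat. Qed.

Lemma mprod1 (K : ccMonoidType) (u : K) : mprod [mset u] = u.
Proof. by rewrite /mprod enum_msetn big_seq1. Qed.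

Lemma mprod_seq (K : ccMonoidType) (s : seq K) :
  mprod (seq_mset s) = (\prod_(x <- s) x)%g.
Proof. exact/perm_big/perm_eq_seq_mset. Qed.

Lemma msetB1D (K : choiceType) (u : K) (z : {mset K}) :
  u \in z -> [mset u] `+` (z `\` [mset u]) = z.
Proof. by move=> uz; rewrite msetBDKC // msub1set. Qed.

Lemma mset_split (K : choiceType) (z : {mset K}) n : (n <= size z)%N ->
  exists x y, z = x `+` y /\ size x = n.
Proof.
move=> le_n; exists (seq_mset (take n (enum_mset z))), (seq_mset (drop n (enum_mset z))).
split; last by rewrite size_seq_mset size_takel.
apply/msetP => u; rewrite msetE2 !mset_seqE -count_cat cat_take_drop.
by rewrite count_mem_mset.
Qed.

End MultisetExtra.

(** * Units, atoms and strong primariness pass to the reduced monoid *)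

Section Reduced.
Variable H : ccMonoidType.
Implicit Types (a b : H) (r s : reduced H).

Lemma pi_redM a b : pi_red (a * b)%g = (pi_red a * pi_red b)%g.
Proof. by rewrite -red_mulE. Qed.

Lemma pi_red_prod (s : seq H) :
  pi_red (\prod_(x <- s) x)%g = (\prod_(x <- s) pi_red x)%g.
Proof. by elim: s => [|x s IHs]; rewrite ?big_nil ?big_cons // pi_redM IHs. Qed.

Lemma pi_red_unit a : pi_red a = 1%g <-> units a.
Proof.
split=> [/esym/pi_redP/associatedP[e ue ->]|ua]; first by rewrite mul1g.
by apply/esym/pi_redP/associatedP; exists a; rewrite ?mul1g.
Qed.

Lemma units_reduced r : units r -> r = 1%g.
Proof.
have [a ->] := pi_red_surj r => -[s]; have [b ->] := pi_red_surj s.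
rewrite -pi_redM => /pi_red_unit[c abc]; apply/pi_red_unit.
by exists (b * c)%g; rewrite mulgA.
Qed.

Lemma atoms_pi_red a : atoms a -> atoms (pi_red a).
Proof.
move=> [nua irr]; split=> [/units_reduced/pi_red_unit//|r s].
have [b ->] := pi_red_surj r; have [c ->] := pi_red_surj s.
rewrite -pi_redM => /esym/pi_redP/associatedP[e ue aE].
have [|ub|uc] := irr b (c * e)%g; first by rewrite mulgA.
  by left; rewrite (pi_red_unit b).2 //; exact: units1.
right; rewrite (pi_red_unit c).2; first exact: units1.
by case: uc => f cef; exists (e * f)%g; rewrite mulgA.
Qed.

Lemma power_in_red a n : power_in a n -> power_in (pi_red a) n.
Proof.
move=> [n_gt0 sub]; split=> // _ [t [tn nut] <-].
(* Representatives of non-unit classes are non-units, so the inclusion in [H] applies to them. *)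
have [|b _ bE] := sub (\prod_(x <- map repr t) x)%g.
  exists (map repr t) => //; split=> [|x /mapP[y yt ->] ux]; first by rewrite size_map.
  apply: (nut _ yt); have -> : y = pi_red (repr y) by rewrite /pi_red reprK.
  by rewrite (pi_red_unit _).2 //; exact: units1.
exists (pi_red b) => //; rewrite -pi_redM bE pi_red_prod big_map.
by apply: eq_bigr => x _; rewrite /pi_red reprK.
Qed.

Lemma strongly_primary_red : strongly_primary H -> strongly_primary (reduced H).
Proof.
move=> [nu prim]; split=> [uT|r nur].
  apply: nu; apply/seteqP; split=> // a _; apply/pi_red_unit/units_reduced.
  by rewrite uT.
have [a rE] := pi_red_surj r; have [|n an] := prim a.
  by move=> /pi_red_unit a1; apply: nur; rewrite rE a1; exact: units1.
by exists n; rewrite rE; exact: power_in_red.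
Qed.

End Reduced.

(** * Existence and boundedness of factorizations *)

Section Factor.
Local Open Scope mset_scope.
Variable H : ccMonoidType.
Local Notation K := (reduced H).
Implicit Types (r s : K) (z w : {mset K}).

(* [factorizations a] is [facts (pi_red a)]. *)
Definition facts r : set {mset K} :=
  [set z | (forall u, u \in z -> atoms u) /\ mprod z = r].

Lemma factsM r s z w : facts r z -> facts s w -> facts (r * s)%g (z `+` w).
Proof.
move=> [zat <-] [wat <-]; split; last exact: mprodD.
by move=> u /msetDP[/zat|/wat].
Qed.

Lemma facts_atom (u : K) : atoms u -> facts u [mset u].
Proof. by move=> uat; split; [move=> v /mset1P-> | exact: mprod1]. Qed.

Lemma facts_sub r z w : facts r (z `+` w) -> facts (mprod w) w.
Proof. by move=> [zwat _]; split=> // u uw; apply: zwat; rewrite in_msetD uw orbT. Qed.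

Lemma factsB1 (u : K) s z : facts (u * s)%g z -> u \in z ->
  facts s (z `\` [mset u]).
Proof.
move=> [zat zE] uz; split=> [v|]; first by rewrite in_msetB1 => /andP[_ /zat].
by apply: (@cmulI _ u); rewrite -zE -{2}(msetB1D uz) mprodD mprod1.
Qed.

Section StronglyPrimary.
Hypothesis prim : strongly_primary K.

(* If all n-fold products of non-units lie in rK, then r is not a product of
   more than n non-units, by cancellation. *)
Lemma nonunit_length_bound r : exists n, forall t : seq K,
  (forall x, x \in t -> ~ units x) -> (\prod_(x <- t) x)%g = r -> (size t <= n)%N.
Proof.
have [ur|nur] := pselect (units r).
  exists 0%N => -[//|x t] nut; rewrite big_cons => xtr; exfalso.
  apply: (nut x); first exact: mem_head.
  case: ur => v rv; exists ((\prod_(y <- t) y) * v)%g.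
  by rewrite mulgA xtr.
have [n [n_gt0 sub]] := prim.2 r nur; exists n => t nut tr.
rewrite leqNgt; apply/negP => n_lt.
have [|y _ yE] := sub (\prod_(x <- take n t) x)%g.
  exists (take n t) => //; split; first by rewrite size_takel // ltnW.
  by move=> x /mem_take/nut.
case E : (drop n t) => [|x t'].
  by move: (congr1 size E) => /=; rewrite size_drop; lia.
apply: (nut x).
  by rewrite -(cat_take_drop n t) mem_cat E mem_head orbT.
exists (y * \prod_(x <- t') x)%g; apply: (@cmulI _ r).
rewrite mulg1 -[in RHS]tr -(cat_take_drop n t) big_cat E big_cons -yE /=.
by rewrite -[RHS]mulgA [(y * (x * _))%g]Monoid.mulmCA.
Qed.

(** In a product of non-units, a factor that is not an atom splits into two non-units, which
    lengthens the product. The bound [n] on the length stops this; the induction is on the room left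
    below [n]. *)
Lemma facts_neq0 r : facts r !=set0.
Proof.
have [n le_n] := nonunit_length_bound r.
suff ind k : forall t : seq K, (forall x, x \in t -> ~ units x) ->
    (\prod_(x <- t) x)%g = r -> (n - size t <= k)%N -> facts r !=set0.
  have [ur|nur] := pselect (units r).
    apply: (ind n [::]) => //; last by rewrite leq_subr.
    by rewrite big_nil (units_reduced ur).
  apply: (ind n [:: r]); rewrite ?leq_subr ?big_seq1 //.
  by move=> x; rewrite inE => /eqP->.
elim: k => [|k IHk] t nut tr le_k.
all: have [tat|] := pselect (forall x, x \in t -> atoms x);
  first by exists (seq_mset t); split;
    [move=> u; rewrite (perm_mem (perm_eq_seq_mset t)); exact: tat
    | rewrite mprod_seq].
all: move=> /existsNP[x /not_implyP[xt natx]].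
all: have [b [c [xE nub nuc]]] : exists b c, [/\ x = (b * c)%g, ~ units b & ~ units c].
1,3: apply: contrapT => nbc; apply: natx; split; [exact: nut|move=> b c xE];
  apply: contrapT => /not_orP[nub nuc]; apply: nbc; by exists b, c.
all: pose t' := [:: b, c & rem x t].
all: have nut' : forall y, y \in t' -> ~ units y
  by move=> y; rewrite !inE => /or3P[/eqP->|/eqP->|/mem_rem/nut].
all: have t'r : (\prod_(y <- t') y)%g = r
  by rewrite -tr (perm_big _ (perm_to_rem xt)) !big_cons mulgA -xE.
all: have := le_n _ nut' t'r; have := size_rem xt; have : (0 < size t)%N by case: (t) xt.
  by rewrite /=; lia.
by move=> t0 st le_t'; apply: (IHk t') => //; move: le_t' st => /=; lia.
Qed.

Lemma facts_bounded r : exists n, forall z, facts r z -> (size z <= n)%N.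
Proof.
have [n le_n] := nonunit_length_bound r; exists n => z [zat zr].
by apply: le_n => // x /zat[].
Qed.

(** Any [n] of the atoms in [z] are non-units, so their product is already a multiple of [r]. *)
Lemma facts_pow_in r n s z : power_in r n -> facts s z -> (n <= size z)%N ->
  exists q, s = (r * q)%g.
Proof.
move=> [n_gt0 sub] [zat <-] /mset_split[x [y [zE xn]]].
have [|q _ qE] := sub (mprod x).
  exists (enum_mset x) => //; split=> // v vx.
  by have [] : atoms v by apply: zat; rewrite zE in_msetD vx.
by exists (q * mprod y)%g; rewrite zE mprodD mulgA qE.
Qed.

End StronglyPrimary.

End Factor.

(** * Chains of factorizations and tameness *)

Section Catenary.
Local Open Scope mset_scope.
Variable H : ccMonoidType.
Local Notation K := (reduced H).
Implicit Types (r s : K) (z w : {mset K}) (N : nat).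

Lemma msubset_size z w : z `<=` w -> (size z <= size w)%N.
Proof. by move=> /msetBDKC <-; rewrite size_msetD leq_addr. Qed.

Lemma fdistC z w : fdist z w = fdist w z.
Proof. by rewrite /fdist maxnC. Qed.

Lemma fdistDl (q z w : {mset K}) : fdist (q `+` z) (q `+` w) = fdist z w.
Proof. by rewrite /fdist !msetBDl. Qed.

Lemma fdist_le_max z w : (fdist z w <= maxn (size z) (size w))%N.
Proof.
have := msubset_size (msubsetDl z w); have := msubset_size (msubsetDl w z).
by rewrite /fdist geq_max !leq_max => -> ->; rewrite orbT.
Qed.

Lemma size_le_fdist z w : (size z <= size w + fdist z w)%N.
Proof.
have : z `<=` w `+` (z `\` w) by rewrite -subset_msetBLR msubset_refl.
by move=> /msubset_size; rewrite size_msetD /fdist; lia.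
Qed.

(** The chains of [catenary_elt]; as there, [t] omits the starting point [z]. *)
Definition linked N r z w := exists t : seq {mset K},
  [/\ forall y, y \in t -> facts r y,
      path (fun x y => (fdist x y <= N)%N) z t & last z t = w].

Lemma linked1 N r z w : facts r w -> (fdist z w <= N)%N -> linked N r z w.
Proof.
move=> rw le_N; exists [:: w]; split=> //=; last by rewrite le_N.
by move=> y; rewrite inE => /eqP->.
Qed.

Lemma linked_trans N r y z w : linked N r y z -> linked N r z w -> linked N r y w.
Proof.
move=> [t [rt pt <-]] [t' [rt' pt' <-]]; exists (t ++ t'); split.
- by move=> x; rewrite mem_cat => /orP[/rt|/rt'].
- by rewrite cat_path pt.
- by rewrite last_cat.
Qed.

Lemma linked_sym N r z w : facts r z -> linked N r z w -> linked N r w z.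
Proof.
move=> rz [t [rt pt <-]]; exists (rev (belast z t)); split.
- move=> y; rewrite mem_rev => /mem_belast; rewrite inE => /orP[/eqP->//|/rt//].
- rewrite rev_path; apply: sub_path pt => x y /=.
  by rewrite fdistC.
- case: t {rt pt} => //= x t.
  by rewrite rev_cons last_rcons.
Qed.

Lemma linkedDl N r s q z w : facts r q -> linked N s z w ->
  linked N (r * s)%g (q `+` z) (q `+` w).
Proof.
move=> rq [t [st pt <-]]; exists (map (msetD q) t); split.
- by move=> _ /mapP[y /st sy ->]; exact: factsM.
- rewrite path_map; apply: sub_path pt => x y /=.
  by rewrite fdistDl.
- by rewrite last_map.
Qed.

(** Replacing [N.+1] atoms by a factorization of their product into at most [N] atoms is a step of
    size at most [N.+1] that shortens. Two factorizations with at most [N.+1] atoms are then one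
    step apart. *)
Lemma linked_of_bounded_minlen N : (forall r, exists2 z, facts r z & (size z <= N)%N) ->
  forall r z w, facts r z -> facts r w -> linked N.+1 r z w.
Proof.
move=> minN.
suff short n : forall r z, facts r z -> (size z <= n)%N ->
    exists2 x, facts r x /\ (size x <= N.+1)%N & linked N.+1 r z x.
  move=> r z w rz rw; have [x [rx xN] zx] := short _ _ _ rz (leqnn _).
  have [y [ry yN] wy] := short _ _ _ rw (leqnn _).
  apply: (linked_trans zx); apply: (linked_trans _ (linked_sym rw wy)).
  by apply: linked1 => //; apply: leq_trans (fdist_le_max _ _) _; rewrite geq_max xN.
elim: n => [|n IHn] r z rz zn.
  exists z; first by split=> //; apply: leq_trans zn _.
  by apply: linked1 => //; rewrite /fdist msetBxx size_mset0.
have [zN|Nz] := leqP (size z) N.+1.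
  by exists z => //; apply: linked1 => //; rewrite /fdist msetBxx size_mset0.
have [x [y [zE xN]]] := mset_split (ltnW Nz).
have [x' x'f x'N] := minN (mprod x).
have xf : facts (mprod x) x by apply: (@facts_sub _ r y); rewrite msetDC -zE.
have yf : facts (mprod y) y by apply: (@facts_sub _ r x); rewrite -zE.
have rE : r = (mprod x * mprod y)%g by rewrite -mprodD -zE; case: rz.
have rz' : facts r (x' `+` y) by rewrite rE; exact: factsM.
have [|v vf link] := IHn _ _ rz'.
  by move: zn; rewrite zE !size_msetD; lia.
exists v => //; apply: linked_trans link; apply: linked1 => //.
rewrite zE ![_ `+` y]msetDC fdistDl; apply: leq_trans (fdist_le_max _ _) _.
by rewrite xN geq_max leqnn leqW.
Qed.

(** The condition in [tame_degree], with the factorization containing [u] already written as [u]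
    plus a factorization [w] of the cofactor. *)
Definition tame_step (u : K) N := forall s z, facts (u * s)%g z ->
  exists2 w, facts s w & (fdist z ([mset u] `+` w) <= N)%N.

Section StronglyPrimary.
Hypothesis prim : strongly_primary K.

Lemma linked_of_tame (u : K) n T N : atoms u -> power_in u n -> tame_step u T ->
  (n <= N.+1)%N -> (T <= N)%N ->
  forall r z w, facts r z -> facts r w -> linked N r z w.
Proof.
move=> uat un tu nN TN r; have [m] := facts_bounded prim r.
elim: m r => [|m IHm] r le_m z w rz rw.
  apply: linked1 => //; apply: leq_trans (fdist_le_max _ _) _.
  by rewrite geq_max !(leq_trans (le_m _ _)).
have [small|large] := leqP (maxn (size z) (size w)) N.
  by apply: linked1 => //; apply: leq_trans (fdist_le_max _ _) _.
have [s rE] : exists s, r = (u * s)%g.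
  (* The longer of [z] and [w] has at least [N.+1], hence at least [n] atoms. *)
  have [zn|zn] := leqP n (size z); first exact: facts_pow_in un rz zn.
  apply: facts_pow_in un rw _; move: large; lia.
rewrite rE in rz rw le_m *.
have [z1 z1f zz1] := tu _ _ rz; have [w1 w1f ww1] := tu _ _ rw.
have uf := facts_atom uat.
apply: linked_trans (linked1 (factsM uf z1f) (leq_trans zz1 TN)) _.
apply: linked_trans (linked_sym rw (linked1 (factsM uf w1f) (leq_trans ww1 TN))).
(* Cancelling [u] lowers the bound on all lengths by one. *)
apply: linkedDl => //; apply: IHm => // x xf.
by have := le_m _ (factsM uf xf); rewrite size_msetD size_mset1.
Qed.

Hypothesis tame : forall u : K, atoms u -> exists T, tame_step u T.

(** The atoms of one fixed factorization of [r] are split off in turn by tame steps, so the total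
    change of length depends only on [r]. *)
Lemma tame_divisor r : exists T, forall s z, facts (r * s)%g z ->
  exists w, [/\ facts s w, (size w <= size z + T)%N & (size z <= size w + T)%N].
Proof.
have [q [qat <-]] := facts_neq0 prim r.
rewrite /mprod; have {qat} : forall u, u \in enum_mset q -> atoms u by exact: qat.
elim: (enum_mset q) => [|u t IHt] tat.
  by exists 0%N => s z; rewrite big_nil mul1g => sz; exists z; rewrite addn0.
have [T IH] : exists T, forall s z, facts (\prod_(u <- t) u * s)%g z ->
    exists w, [/\ facts s w, (size w <= size z + T)%N & (size z <= size w + T)%N].
  by apply: IHt => v vt; apply: tat; rewrite inE vt orbT.
have [T' tu] := tame (tat u (mem_head _ _)).
(* [T'] is for the tame step and the extra one for the removed atom [u]. *)
exists (T + T').+1 => s z; rewrite big_cons -mulgA => /tu[x /IH[w [sw wx xw]] zx].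
exists w; have := size_le_fdist z ([mset u] `+` x).
have := size_le_fdist ([mset u] `+` x) z; rewrite fdistC size_msetD size_mset1.
by split=> //; lia.
Qed.

End StronglyPrimary.

End Catenary.

(** * Lengths and gaps between consecutive lengths *)

Section Lengths.
Variable H : ccMonoidType.
Local Notation K := (reduced H).
Implicit Types (r s b : K) (d k m n x y N : nat).

Definition len r n := exists2 z, facts r z & size z = n.

Definition gap r m n :=
  [/\ len r m, len r n, (m < n)%N & forall l, len r l -> ~~ (m < l < n)%N].

Lemma lenM r s m n : len r m -> len s n -> len (r * s)%g (m + n).
Proof.
move=> [z rz <-] [w sw <-]; exists (z `+` w)%mset; first exact: factsM.
by rewrite size_msetD.
Qed.

Lemma len1 : len 1%g 0.
Proof.
exists mset0; last by rewrite size_mset0.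
by split=> [u|]; [rewrite in_mset0 | rewrite /mprod big_mset0].
Qed.

Lemma len_atomX (u : K) n : atoms u -> len (u ^+ n)%g n.
Proof.
move=> uat; elim: n => [|n IHn]; first exact: len1.
rewrite expgS -add1n; apply: lenM IHn.
by exists [mset u]%mset; [exact: facts_atom | rewrite size_mset1].
Qed.

(** Of the [k] copies of [b], [j] are factored with length [m + d] and the others with length
    [m]. *)
Lemma lenX b m d k j : len b m -> len b (m + d) -> (j <= k)%N ->
  len (b ^+ k)%g (k * m + j * d).
Proof.
move=> bm bmd; elim: k j => [|k IHk] [|j] // jk; first exact: len1.
  by rewrite expgS mulSn -addnA; apply: lenM => //; exact: IHk.
have -> : (k.+1 * m + j.+1 * d = (m + d) + (k * m + j * d))%N by lia.
by rewrite expgS; apply: lenM => //; exact: IHk.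
Qed.

Lemma len_atom r n : len r n -> (0 < n)%N -> exists u s, atoms u /\ r = (u * s)%g.
Proof.
move=> [z [zat zr] <-]; case: (mset_0Vmem z) => [->|[u uz] _].
  by rewrite size_mset0.
exists u, (mprod (z `\` [mset u])%mset); split; first exact: zat.
by rewrite -zr -{1}(msetB1D uz) mprodD mprod1.
Qed.

Lemma len_nonunit r n : len r n -> (0 < n)%N -> ~ units r.
Proof.
move=> rn n0 [v]; have [u [s [[nuu _] ->]]] := len_atom rn n0.
by rewrite -mulgA => usv; apply: nuu; exists (s * v)%g.
Qed.

Lemma gap_around r m n x : len r m -> len r n -> (m <= x < n)%N ->
  exists m' n', gap r m' n' /\ (m' <= x < n')%N.
Proof.
move=> rm rn /andP[mx xn].
(* The greatest length up to [x] is found through its least distance [i] from [x]. *)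
have [|i [ri ix] le_i] := @ex_least_nat [set i | len r (x - i) /\ (i <= x)%N].
  by exists (x - m)%N => /=; rewrite subKn // leq_subr.
have [|n' [rn' xn'] le_n'] := @ex_least_nat [set l | len r l /\ (x < l)%N].
  by exists n.
exists (x - i)%N, n'; split; last by rewrite xn' leq_subr.
split=> //; first by lia.
move=> l rl; apply/negP => /andP[il ln'].
have [xl|lx] := ltnP x l; first by have := le_n' l (conj rl xl); lia.
have /le_i : len r (x - (x - l)) /\ (x - l <= x)%N by rewrite subKn ?leq_subr.
lia.
Qed.

(** Some step of a chain from length [m] to length [n] jumps over the whole gap, and a step changes
    the length by at most [N]. *)
Lemma linked_gap_le N r m n :
  (forall z w, facts r z -> facts r w -> linked N r z w) ->
  gap r m n -> (n - m <= N)%N.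
Proof.
move=> link [[z rz zm] [w rw wn] mn between].
have [t [rt pt tw]] := link _ _ rz rw.
have {zm} : (size z <= m)%N by rewrite zm.
have {tw wn} : (n <= size (last z t))%N by rewrite tw wn.
elim: t z {rz} rt pt => [|v t IHt] z rt /=; first by lia.
move=> /andP[zv pt] nt zm.
have rv : facts r v by apply: rt; exact: mem_head.
have [vm|mv] := leqP (size v) m.
  by apply: (IHt v) => // y yt; apply: rt; rewrite inE yt orbT.
have : (n <= size v)%N.
  by have := between (size v); rewrite mv /= -leqNgt; apply; exists v.
have vz := size_le_fdist v z; rewrite fdistC in vz => nv.
rewrite leq_subLR; exact: leq_trans nv (leq_trans vz (leq_add zm zv)).
Qed.

(** * Structure of lengths when all distances lie between [d] and [C] *)

Section Distances.
Variables (d C m0 : nat) (b0 : K).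
Hypotheses (d_gt0 : (0 < d)%N) (b0_m0 : len b0 m0) (b0_m0d : len b0 (m0 + d)).
Hypothesis d_min : forall r m n, gap r m n -> (d <= n - m)%N.

(* With q = (n - m) / d, the product of b0^q and r has two lengths at distance
   (n - m) mod d, which is less than d. *)
Lemma len_eqmod_le r m n : len r m -> len r n -> (m <= n)%N -> m = n %[mod d].
Proof.
move=> rm rn mn; apply/eqP; rewrite eq_sym eqn_mod_dvd //; apply/negP => /negP nd.
have [q [e [nE e_gt0 ed]]] : exists q e, [/\ n = (m + q * d + e)%N, (0 < e)%N & (e < d)%N].
  exists ((n - m) %/ d)%N, ((n - m) %% d)%N; split; [|by rewrite lt0n|exact: ltn_pmod].
  by rewrite -addnA -divn_eq subnKC.
have l1 := lenM (lenX b0_m0 b0_m0d (leqnn q)) rm.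
have l2 := lenM (lenX b0_m0 b0_m0d (leq0n q)) rn.
rewrite nE mul0n addn0 in l2.
(* This [x] is the length from [l1], so the gap starts at [x] and ends at the latest at the length
   from [l2], which is [x + e]. *)
have [|m' [n' [g /andP[m'x xn']]]] := gap_around (x := (q * m0 + q * d + m)%N) l1 l2.
  by rewrite leqnn /=; lia.
have [_ _ _ between] := g; have := between _ l1; have := between _ l2.
have := d_min g; lia.
Qed.

Lemma len_eqmod r m n : len r m -> len r n -> m = n %[mod d].
Proof.
move=> rm rn; have [mn|/ltnW nm] := leqP m n; first exact: len_eqmod_le rm rn mn.
exact/esym/(len_eqmod_le rn rm nm).
Qed.

Hypothesis prim : strongly_primary K.
Hypothesis tame : forall u : K, atoms u -> exists T, tame_step u T.
Hypothesis gap_le : forall r m n, gap r m n -> (n - m <= C)%N.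

(* b0 ^+ C.+1 has the lengths of an arithmetic progression longer than every
   gap; any r with a long enough factorization is a multiple of it, and tameness
   keeps the lengths of the cofactor near those of r. *)
Lemma almost_arithmetic_lengths : exists M, forall r m n x, len r m -> len r n ->
  (m + M <= x)%N -> (x + M <= n)%N -> x = m %[mod d] -> len r x.
Proof.
pose k := C.+1; pose B := (b0 ^+ k)%g.
have Blen j : (j <= k)%N -> len B (k * m0 + j * d) := lenX b0_m0 b0_m0d.
have nuB : ~ units B by apply: len_nonunit (Blen k (leqnn _)) _; nia.
have [nB BnB] := prim.2 B nuB; have [T Bt] := tame_divisor prim tame B.
(* [nB] makes [r] a multiple of [B], [T] absorbs the change of length on passing to the cofactor
   [s], and [k * m0] is the shortest length used for [B]. *)
exists (nB + T + k * m0).+1 => r m n x rm rn mx xn xm.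
have [s rE] : exists s, r = (B * s)%g.
  by case: rn => z rz zn; apply: facts_pow_in BnB rz _; lia.
have [p sp pm] : exists2 p, len s p & (p <= m + T)%N.
  have [z + <-] := rm; rewrite rE => /Bt[w [sw wz _]].
  by exists (size w) => //; exists w.
have [p' sp' p'n] : exists2 p', len s p' & (n <= p' + T)%N.
  have [z + <-] := rn; rewrite rE => /Bt[w [sw _ wz]].
  by exists (size w) => //; exists w.
(* The largest length [y] of [s] up to [x - k * m0] is less than [C] below it, so a length of [B]
   can fill the difference. *)
have [|y [y' [g /andP[yx xy']]]] := @gap_around s p p' (x - k * m0) sp sp'.
  by lia.
have yyC := gap_le g; have [sy _ _ _] := g.
have Bsy : len r (k * m0 + y).
  by rewrite rE -[(k * m0)%N]addn0 -(mul0n d); apply: lenM sy; apply: Blen.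
have /eqP : x = k * m0 + y %[mod d] by rewrite xm; exact: len_eqmod rm Bsy.
rewrite eqn_mod_dvd; last by lia.
move=> /dvdnP[j xE].
have jk : (j <= k)%N by rewrite /k in yyC xE *; nia.
have -> : x = (k * m0 + j * d + y)%N by lia.
by rewrite rE; apply: lenM sy; exact: Blen.
Qed.

Definition lenU k n := exists2 r, len r k & len r n.

(** If [x] is at least [M] above [k], the lengths of an element with lengths [k] and [y] contain
    [x]; if at least [M] below, those of one with lengths [l] and [k] do. Otherwise [t] has both
    lengths [k] and [x]. *)
Lemma almost_arithmetic_unions : exists M, forall k l y x, lenU k l -> lenU k y ->
  (l + M <= x)%N -> (x + M <= y)%N -> x = k %[mod d] -> lenU k x.
Proof.
have [M aal] := almost_arithmetic_lengths.
have [|u [_ [uat _]]] := len_atom b0_m0d; first by lia.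
pose i := (2 * M * m0 + M * d)%N; exists (i + M)%N.
move=> k l y x [r rk rl] [s sk sy] lx xy xk.
have [kx|xk_lt] := leqP (k + M) x.
  by exists s => //; apply: aal sk sy kx _ xk; lia.
have [xMk|kxM] := leqP (x + M) k.
  exists r => //; apply: (aal _ _ _ _ rl rk _ xMk); first by lia.
  by rewrite xk; exact: len_eqmod rk rl.
(* Here [x < k + M], while the margin gives [i + M <= x]. *)
have ik : (i <= k)%N by lia.
pose t := (b0 ^+ (2 * M) * u ^+ (k - i))%g.
have tlen j : (j <= 2 * M)%N -> len t (2 * M * m0 + j * d + (k - i)).
  by move=> jM; apply: lenM; [exact: lenX | exact: len_atomX].
(* The choice [j = M] gives [k]; as [x] is within [M <= M * d] of [k], some [j] up to [2 * M] gives
   [x]. *)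
have [j jM xE] : exists2 j, (j <= 2 * M)%N & (x + M * d = k + j * d)%N.
  have MMd : (M <= M * d)%N by rewrite leq_pmulr.
  have : x + M * d = k %[mod d] by rewrite addnC modnMDl.
  move=> /eqP; rewrite eqn_mod_dvd; last by lia.
  move=> /dvdnP[j jE]; exists j; last by lia.
  rewrite -(leq_pmul2r d_gt0); lia.
exists t.
  have -> : k = (2 * M * m0 + M * d + (k - i))%N by rewrite subnKC.
  by apply: tlen; lia.
have -> : x = (2 * M * m0 + j * d + (k - i))%N by rewrite /i; lia.
exact: tlen.
Qed.

End Distances.

End Lengths.

(** * Translation to the invariants of [H] with extended integer values *)

Local Open Scope ring_scope.

Lemma zapP (m d : nat) (x : int) : (0 < d)%N ->
  zap m%:Z d%:Z x <-> exists n, [/\ x = n%:Z, (m <= n)%N & n = m %[mod d]].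
Proof.
move=> d0; split=> [[j _ <-]|[n [-> mn /eqP]]].
  by exists (m + d * j)%N; split; [lia | exact: leq_addr | rewrite addnC mulnC modnMDl].
rewrite eqn_mod_dvd // => /dvdnP[j nm]; exists j => //.
by rewrite mulrC -PoszM -nm -subzn // addrC subrK.
Qed.

Section Bridge.
Variable H : ccMonoidType.
Implicit Types (a : H) (k m n N M d : nat).

Lemma lengthsP a (x : int) :
  lengths a x <-> exists2 n, x = n%:Z & len (pi_red a) n.
Proof.
split=> [[z za <-]|[_ -> [z za <-]]]; last by exists z.
by exists (size z) => //; exists z.
Qed.

Lemma gap_set_distances a m n : gap (pi_red a) m n -> Delta H (n - m)%N%:Z.
Proof.
move=> [am an mn between]; exists (lengths a); first by exists a.
exists m%:Z, n%:Z; split.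
- by apply/lengthsP; exists m.
- by apply/lengthsP; exists n.
- by rewrite ltz_nat.
- by move=> _ /lengthsP[l -> /between]; rewrite !ltz_nat.
- by rewrite subzn // ltnW.
Qed.

Lemma DeltaP (x : int) :
  Delta H x <-> exists r m n, gap (H := H) r m n /\ x = (n - m)%N%:Z.
Proof.
split=> [[_ [a _ <-]]|[r [m [n [g ->]]]]]; last first.
  by have [a rE] := pi_red_surj r; apply: (@gap_set_distances a); rewrite -rE.
move=> [_ [_ [/lengthsP[m -> am] /lengthsP[n -> an]]]].
rewrite ltz_nat => mn between ->; exists (pi_red a), m, n; split; last first.
  by rewrite subzn // ltnW.
split=> // l al; rewrite -!ltz_nat; apply: between.
by apply/lengthsP; exists l.
Qed.

Lemma Delta_finite N :
  (forall r (z w : {mset (reduced H)}%mset), facts r z -> facts r w -> linked N r z w) ->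
  finite_set (Delta H).
Proof.
move=> link; apply: (@sub_finite_set _ _ (Posz @` `I_N.+1)).
  move=> _ /DeltaP[r [m [n [g ->]]]]; exists (n - m)%N => //=.
  by rewrite ltnS (linked_gap_le _ g) //; exact: link.
exact/finite_image/finite_II.
Qed.

Lemma catenary_le N :
  (forall r (z w : {mset (reduced H)}%mset), facts r z -> facts r w -> linked N r z w) ->
  (catenary H <= (N%:Z)%:E)%E.
Proof.
move=> link; apply: esup_le => _ [a _ <-]; apply: emin_le => z w.
exact: link.
Qed.

Lemma calUP k (x : int) : calU H k x <-> exists2 n, x = n%:Z & lenU H k n.
Proof.
split=> [[_ [[a _ <-] /lengthsP[k' [<-] ak] /lengthsP[n -> an]]]|].
  by exists n => //; exists (pi_red a).
move=> [n -> [r]]; have [a ->] := pi_red_surj r => ak an.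
exists (lengths a); last by apply/lengthsP; exists n.
by split; [exists a | apply/lengthsP; exists k].
Qed.

(** Otherwise [x + M - 1] would bound [calU H k], and hence [rho], from above; this also covers an
    infinite [rho]. *)
Lemma le_rhoB k M (x : int) :
  (x%:E <= rho H k - (M%:Z)%:E)%E -> calU H k !=set0 ->
  exists2 y, lenU H k y & (x + M%:Z <= y%:Z)%R.
Proof.
move=> le_x [y0 Uy0]; apply: contrapT => nex.
have : (rho H k <= (x + M%:Z - 1)%R%:E)%E.
  apply: esup_le => _ [_ /calUP[y -> Uy] <-]; rewrite lee_fin.
  suff : ~ (x + M%:Z <= y%:Z)%R by lia.
  by move=> le_y; apply: nex; exists y.
by case: (rho H k) le_x => [y||] //=; rewrite !lee_fin; lia.
Qed.

Section StronglyPrimary.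
Hypotheses (Htame : locally_tame H) (Hprim : strongly_primary H).
Let prim : strongly_primary (reduced H) := strongly_primary_red Hprim.

Lemma tame_degree_step (u : reduced H) : atoms u ->
  exists2 T, tame_step u T & tame_degree u = (T%:Z)%:E.
Proof.
move=> uat; have [T tameT uT] := emin_ltoo (Htame uat); exists T => // s z usz.
have [c uE] := pi_red_surj u; have [b sE] := pi_red_surj s.
have cb : pi_red (c * b)%g = (u * s)%g by rewrite pi_redM uE sE.
have [w sw] := facts_neq0 prim s.
have zcb : factorizations (c * b)%g z by rewrite -cb in usz; exact: usz.
(* Adding [u] to a factorization of [s] shows that tameness at [u] applies to this product. *)
have ucb : exists2 z', factorizations (c * b)%g z' & u \in z'.
  exists ([mset u] `+` w)%mset; last exact: mset1D1.
  by have := factsM (facts_atom uat) sw; rewrite -cb; exact.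
have [z' [z'f uz' zz']] := tameT _ ucb z zcb.
have usz' : facts (u * s)%g z' by rewrite -cb; exact: z'f.
exists (z' `\` [mset u])%mset; first exact: factsB1 usz' uz'.
by rewrite msetB1D.
Qed.

Lemma lengths_lbound a : lbound (lengths a) 0%R.
Proof. by move=> _ /lengthsP[n -> _]. Qed.

Lemma lengths_neq0 a : lengths a !=set0.
Proof.
have [z az] := facts_neq0 prim (pi_red a); exists (size z)%:Z.
by apply/lengthsP; exists (size z) => //; exists z.
Qed.

Lemma minLP a : exists n, [/\ minL a = n%:Z, len (pi_red a) n &
  forall k, len (pi_red a) k -> (n <= k)%N].
Proof.
have [/lengthsP[n nE an] lb] := least_mem (lengths_neq0 a) (@lengths_lbound a).
exists n; split=> // k ak; rewrite -lez_nat -nE; apply: lb.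
by apply/lengthsP; exists k.
Qed.

Lemma maxLP a : exists2 n, maxL a = n%:Z & len (pi_red a) n.
Proof.
have [N le_N] := facts_bounded prim (pi_red a).
have [|/lengthsP[n nE an] _] := @greatest_mem (lengths a) N%:Z (lengths_neq0 a).
  by move=> _ /lengthsP[n -> [z az <-]]; rewrite lez_nat le_N.
by exists n.
Qed.

Lemma catenary_le_Lambda : (catenary H <= 1 + Lambda H)%E.
Proof.
have minL_le a : ((minL a)%:E <= Lambda H)%E by apply: le_esup; exists a.
(* The value [-oo] is excluded since [Lambda] bounds the minimal length of [1]; so is a negative
   [L]. *)
case E : (Lambda H) minL_le => [L| |] minL_le; last by have := minL_le 1%g.
- have L0 : (0 <= L)%R.
    by have := minL_le 1%g; have [n [-> _ _]] := minLP 1%g; rewrite lee_fin; lia.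
  have -> : (1 + L%:E = ((`|L|%N.+1)%:Z)%:E)%E.
    by rewrite -EFinD; congr (_%:E); lia.
  apply: catenary_le; apply: linked_of_bounded_minlen => r.
  have [a ->] := pi_red_surj r; have [n [nE [z az zn] _]] := minLP a.
  by exists z => //; have := minL_le a; rewrite nE lee_fin zn; lia.
- by rewrite addey // leey.
Qed.

Lemma linked_tame_calM (u : H) : atoms u -> exists2 N,
  forall r (z w : {mset (reduced H)}%mset), facts r z -> facts r w -> linked N r z w
  & ((N%:Z)%:E = maxe (((calM u)%:Z - 1)%R%:E) (tame_degree (pi_red u)))%E.
Proof.
move=> uat; have [T uT ->] := tame_degree_step (atoms_pi_red uat).
have [n nu le_n] := ex_least_nat (Hprim.2 u uat.1).
have -> : calM u = n by exact: least_eq.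
have n0 := nu.1.
(* A factorization with more than [n.-1] atoms is long enough to force divisibility by [u]; [n0]
   makes [n.-1] agree with the integer [n - 1]. *)
exists (maxn n.-1 T); first by apply: linked_of_tame (power_in_red nu) uT _ _;
  [exact: prim | exact: atoms_pi_red | lia | lia].
rewrite -EFin_max; congr (_%:E); lia.
Qed.

End StronglyPrimary.


End Bridge.

Theorem theorem4p1 (H : ccMonoidType)
    (Htame : locally_tame H) (Hprim : strongly_primary H) :
  [/\ (catenary H <= 1 + Lambda H)%E,
      forall u : H, atoms u ->
        (catenary H <=
           maxe (((calM u)%:Z - 1)%R%:E) (tame_degree (pi_red u)))%E
    & finite_set (Delta H)]
  /\
  (Delta H !=set0 ->
   let d := least 0 (Delta H) in
   (exists M : nat, forall a : H,
      zap (minL a) d `&` zitv (minL a + M%:Z)%:E (maxL a - M%:Z)%:E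
        `<=` lengths a
      /\ lengths a `<=` zap (minL a) d)
   /\
   (exists M' : nat, forall k : nat, (0 < k)%N ->
      zap (lambda H k) d
        `&` zitv (lambda H k + M'%:Z)%:E (rho H k - (M'%:Z)%:E)%E
        `<=` calU H k
      /\ calU H k `<=` zap (lambda H k) d)).
Proof.
have prim := strongly_primary_red Hprim.
have tame (u : reduced H) : atoms u -> exists T, tame_step u T.
  by move=> /(tame_degree_step Htame Hprim)[T]; exists T.
have [N link] : exists N, forall r (z w : {mset (reduced H)}%mset),
    facts r z -> facts r w -> linked N r z w.
  (* One atom suffices for a uniform [N], and a factorization of a non-unit provides it. *)
  have [a nua] : exists a : H, ~ units a.
    apply: contrapT => /forallNP allu; apply: Hprim.1; apply/seteqP; split=> // a _.
    exact: contrapT (allu a).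
  have [z [zat za]] := facts_neq0 prim (pi_red a).
  case: (mset_0Vmem z) => [z0|[u /zat uat]].
    by case: nua; apply/pi_red_unit; rewrite -za z0 /mprod big_mset0.
  have [T uT] := tame _ uat; have [n nu] := prim.2 u uat.1.
  exists (n + T)%N; apply: (linked_of_tame prim uat nu uT); lia.
split.
  split; [exact: catenary_le_Lambda | | exact: Delta_finite link].
  move=> u uat; have [N' link' <-] := linked_tame_calM Htame Hprim uat.
  exact: catenary_le link'.
move=> Delta0 d; rewrite /d {d}.
(* Distances are bounded below by 0, so the minimum is attained and [b] realizes it. *)
have [|] := @least_mem (Delta H) 0 Delta0.
  by move=> _ /DeltaP[r [m [n [_ ->]]]].
set d := least _ _ => /DeltaP[b [m0 [n0 [g dE]]]] lbd.
have [b_m0 b_n0 mn0 _] := g.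
have [d0 d0E d0_gt0] : exists2 d0, n0 = (m0 + d0)%N & (0 < d0)%N.
  by exists (n0 - m0)%N; lia.
have {}dE : d = d0%:Z by rewrite dE d0E addKn.
rewrite d0E in b_n0; rewrite dE {mn0 g d0E}.
have d_min (r : reduced H) m n : gap r m n -> (d0 <= n - m)%N.
  by move=> g; rewrite -lez_nat -dE; apply: lbd; apply/DeltaP; exists r, m, n.
have gap_le (r : reduced H) m n : gap r m n -> (n - m <= N)%N.
  by move=> g; apply: linked_gap_le g => z w; exact: link.
have eqmod := len_eqmod d0_gt0 b_m0 b_n0 d_min.
split.
  have [M aal] := almost_arithmetic_lengths d0_gt0 b_m0 b_n0 d_min prim tame gap_le.
  exists M => a; have [m [-> am am_le]] := minLP Hprim a.
  have [n -> an] := maxLP Hprim a; split=> [x [/(zapP _ _ d0_gt0)[y [-> my ym]]]|].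
    rewrite /zitv /= !lee_fin => /andP[mx xn]; apply/lengthsP; exists y => //.
    by apply: (aal _ _ _ _ am an _ _ ym); lia.
  move=> _ /lengthsP[y -> ay]; apply/(zapP _ _ d0_gt0); exists y; split=> //.
    exact: am_le.
  exact: eqmod ay am.
have [M aau] := almost_arithmetic_unions d0_gt0 b_m0 b_n0 d_min prim tame gap_le.
have [u [s [uat _]]] := len_atom b_n0 (ltn_addl m0 d0_gt0).
exists M => k k_gt0.
(* This makes [calU H k] non-empty, so [lambda] is a true minimum. *)
have Uk : lenU H k k by exists (u ^+ k)%g; exact: len_atomX.
have U0 : calU H k !=set0 by exists k%:Z; apply/calUP; exists k.
have [|/calUP[l lE Ul] lb] := @least_mem (calU H k) 0 U0.
  by move=> _ /calUP[n -> _].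
(* Lengths of different elements are compared through their common length [k]. *)
have Ueq x y : lenU H k x -> lenU H k y -> x = y %[mod d0].
  by move=> [r rk rx] [t tk ty]; rewrite -(eqmod _ _ _ rk rx) (eqmod _ _ _ tk ty).
rewrite /lambda lE; split=> [x [/(zapP _ _ d0_gt0)[y [-> ly yl]]]|].
  rewrite /zitv /= lee_fin => /andP[lx] /le_rhoB-/(_ U0)[n Un yn].
  apply/calUP; exists y => //; apply: (aau _ _ _ _ Ul Un); [lia|lia|].
  by rewrite yl; exact: Ueq Ul Uk.
move=> _ /calUP[y -> Uy]; apply/(zapP _ _ d0_gt0); exists y; split=> //.
  by rewrite -lez_nat -lE; apply: lb; apply/calUP; exists y.
exact: Ueq Uy Ul.
Qed.
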